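(* Let $M$ be a matroid with $\kappa(M)<r(M)$. Then $\kappa(M^t)=t(\kappa(M)-1)+1$ for every $t\in\mathbb{N}$.
   Context: A cyclic flat of a matroid $M$ is a flat $F$ such that $M|F$ has no coloops; $\mathcal{Z}(M)$ denotes the set of cyclic flats, and a matroid is determined by its cyclic flats and their ranks. The $t$-expansion: fix $t\in\mathbb{N}$; for each $e\in E(M)$ let $S_e$ be a $t$-element set with $e\in S_e$, the sets $S_e$ pairwise disjoint; for $X\subseteq E(M)$ let $S_X=\bigcup_{e\in X}S_e$. The $t$-expansion $M^t$ is the matroid on $S_{E(M)}$ whose cyclic flats are exactly the sets $S_A$ with $A\in\mathcal{Z}(M)$, with $r_{M^t}(S_A)=t\cdot r_M(A)$. For $X\subseteq E(M)$ let $\overline{X}=E(M)-X$ and $\lambda_M(X)=r(X)+r(\overline{X})-r(M)$. A vertical $k$-separation is a pair $(X,\overline{X})$ with $r(X)\geq k$, $r(\overline{X})\geq k$ and $\lambda_M(X)<k$. The vertical connectivity $\kappa(M)$ is the least $k$ such that $M$ has a vertical $k$-separation if one exists (equivalently, if $E(M)$ is a union of two proper flats), and $\kappa(M)=r(M)$ otherwise. *)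

(* Defs.v *)
From HB Require Import structures.
From mathcomp Require Import all_boot.

Set Implicit Arguments.
Unset Strict Implicit.
Unset Printing Implicit Defensive.

(* The ground set is a subset of an ambient finite type rather than the whole
   type, so that M and its expansion live in the same type and "e \in S e"
   makes sense literally. *)
Record matroid (T : finType) := Matroid {
  ground : {set T};
  indep : {set T} -> bool;
  indep_ground : forall I, indep I -> I \subset ground;
  indep_set0 : indep set0;
  indep_sub : forall I J : {set T}, J \subset I -> indep I -> indep J;
  indep_aug : forall I J : {set T}, indep I -> indep J -> #|I| < #|J| ->
    exists2 e, e \in J :\: I & indep (e |: I)
}.

Section Matroid.
Variable T : finType.
Implicit Types (M N : matroid T) (X Y F A B : {set T}) (k t : nat).

Definition rank M X : nat := \max_(I : {set T} | indep M I && (I \subset X)) #|I|.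

Definition mrank M : nat := rank M (ground M).

Definition basis M B : bool := maxset (indep M) B.

Definition coloop M e : Prop :=
  e \in ground M /\ forall B, basis M B -> e \in B.

Definition flat M F : Prop :=
  F \subset ground M /\
  forall e, e \in ground M :\: F -> rank M F < rank M (e |: F).

Definition restr_indep M X (I : {set T}) : bool := indep M I && (I \subset X).

Fact restr_indep_ground M X I :
  restr_indep M X I -> I \subset ground M :&: X.
Proof. by case/andP=> iI sIX; rewrite subsetI (indep_ground iI). Qed.

Fact restr_indep_set0 M X : restr_indep M X set0.
Proof. by rewrite /restr_indep indep_set0 sub0set. Qed.

Fact restr_indep_sub M X (I J : {set T}) :
  J \subset I -> restr_indep M X I -> restr_indep M X J.
Proof.
move=> sJI /andP[iI sIX].
by rewrite /restr_indep (indep_sub sJI iI) (subset_trans sJI sIX).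
Qed.

Fact restr_indep_aug M X (I J : {set T}) :
  restr_indep M X I -> restr_indep M X J -> #|I| < #|J| ->
  exists2 e, e \in J :\: I & restr_indep M X (e |: I).
Proof.
move=> /andP[iI sIX] /andP[iJ sJX] ltIJ.
have [e eJI ieI] := indep_aug iI iJ ltIJ; exists e => //.
rewrite /restr_indep ieI subUset sub1set sIX andbT /=.
by apply: (subsetP sJX); case/setDP: eJI.
Qed.

Definition restr M X : matroid T :=
  Matroid (@restr_indep_ground M X) (restr_indep_set0 M X)
          (@restr_indep_sub M X) (@restr_indep_aug M X).

Definition cyclic_flat M F : Prop :=
  flat M F /\ forall e, ~ coloop (restr M F) e.

Definition SX (S : T -> {set T}) X : {set T} := \bigcup_(e in X) S e.

(* Cyclic flats and their ranks determine a matroid, so this characterises N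
   uniquely among matroids on T, given M, t and S. *)
Definition is_expansion M t (S : T -> {set T}) N : Prop :=
  [/\ forall e, e \in ground M -> e \in S e /\ #|S e| = t,
      forall e f, e \in ground M -> f \in ground M -> e != f ->
        [disjoint S e & S f],
      ground N = SX S (ground M),
      forall F, cyclic_flat N F <-> exists2 A, cyclic_flat M A & F = SX S A
    & forall A, cyclic_flat M A -> rank N (SX S A) = t * rank M A].

(* Truncated subtraction is harmless: the rank function is subadditive. *)
Definition lambda M X : nat :=
  rank M X + rank M (ground M :\: X) - mrank M.

Definition vertical_separation M k X : bool :=
  [&& X \subset ground M, k <= rank M X, k <= rank M (ground M :\: X)
    & lambda M X < k].

Definition has_vertical_separation M k : bool :=
  [exists X, vertical_separation M k X].

Lemma rank_le_card M X : rank M X <= #|X|.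
Proof. by apply/bigmax_leqP => I /andP[_]; exact: subset_leq_card. Qed.

Lemma has_vertical_separation_dec M :
  decidable (exists k, has_vertical_separation M k).
Proof.
case: (boolP [exists k : 'I_#|T|.+1, has_vertical_separation M k]) => H.
  by left; case/existsP: H => k Hk; exists k.
right=> -[k Hk]; case/negP: H; apply/existsP.
have ltk : k < #|T|.+1.
  have /existsP[X /and4P[_ kX _ _]] := Hk.
  by rewrite ltnS (leq_trans kX) // (leq_trans (rank_le_card M X)) // max_card.
by exists (Ordinal ltk).
Qed.

Definition kappa M : nat :=
  if has_vertical_separation_dec M is left ex_k then ex_minn ex_k
  else mrank M.

End Matroid.

(* Main.v *)
Require Import Defs.
From mathcomp Require Import all_boot zify.

(** The rank function is recovered from the cyclic flats by
    [r(X) = min_A (r(A) + |X - A|)], hence [r_N(S_X) = t r_M(X)], and a minimum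
    vertical separation of [M] expands to one of [N]; this gives the upper bound.
    For the lower bound, let [(Y, Y')] be a vertical separation of [N], and let
    the minima for [Y] and [Y'] be attained at [S_A] and [S_B]. With
    [m = |E - (A :|: B)|] we get
    [lambda_N(Y) >= t (r(A) + r(B) + m - r(M))]. If [r(A) + r(B) + m <= 2 r(M) - 2],
    the [m] elements outside [A :|: B] can be shared between [A] and [B] so that
    both sides stay nonspanning, which produces a vertical separation of [M] of
    small enough order; otherwise the bound is at least [t (r(M) - 1)], and the
    assumption [kappa M < r(M)] suffices. *)

(** * Rank in terms of cyclic flats *)

Section Rank.
Set Implicit Arguments.
Unset Strict Implicit.
Variables (T : finType) (M : matroid T).
Implicit Types (X Y A B I : {set T}).

Lemma card_indep_le_rank X I : indep M I -> I \subset X -> #|I| <= rank M X.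
Proof.
by move=> iI sIX; apply: (bigmax_sup I); rewrite ?iI.
Qed.

Lemma rank_leP X n :
  (forall I, indep M I -> I \subset X -> #|I| <= n) -> rank M X <= n.
Proof. by move=> H; apply/bigmax_leqP => I /andP[]; exact: H. Qed.

Lemma rank_witness X :
  exists I, [/\ indep M I, I \subset X & #|I| = rank M X].
Proof.
have cP : 0 < #|[pred I : {set T} | indep M I && (I \subset X)]|.
  by apply/card_gt0P; exists set0; rewrite inE indep_set0 sub0set.
have [I /andP[iI sI] e] := eq_bigmax_cond (fun I : {set T} => #|I|) cP.
by exists I; split=> //; rewrite -e.
Qed.

Lemma rank_mono X Y : X \subset Y -> rank M X <= rank M Y.
Proof.
move=> sXY; apply: rank_leP => I iI sI.
by apply: card_indep_le_rank => //; exact: subset_trans sXY.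
Qed.

Lemma rank_subadd X Y : rank M (X :|: Y) <= rank M X + rank M Y.
Proof.
apply: rank_leP => I iI sI; rewrite -(cardsID X I); apply: leq_add.
  by apply: card_indep_le_rank; [exact: indep_sub (subsetIl _ _) iI | exact: subsetIr].
apply: card_indep_le_rank; first exact: indep_sub (subsetDl _ _) iI.
by rewrite subDset.
Qed.

(** The inequality half of the rank formula, valid for every set [A], cyclic flat or not. *)
Lemma rank_le_add_card X A : rank M X <= rank M A + #|X :\: A|.
Proof.
apply: leq_trans (_ : rank M (A :|: (X :\: A)) <= _).
  by apply: rank_mono; rewrite -subDset.
by apply: leq_trans (rank_subadd _ _) _; rewrite leq_add2l rank_le_card.
Qed.

(** Otherwise a largest independent subset of [A :\ e] would be a basis of [restr M A] avoiding
    [e]. *)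
Lemma rank_coloop A e :
  coloop (restr M A) e -> e \in A /\ rank M (A :\ e) < rank M A.
Proof.
case=> /setIP[_ eA] eB; split=> //.
rewrite ltnNge; apply/negP => le_r.
have [I [iI sI cI]] := rank_witness (A :\ e).
have /eB eI : basis (restr M A) I.
  apply/maxsetP; split.
    by rewrite /= /restr_indep iI (subset_trans sI (subsetDl _ _)).
  move=> J /andP[iJ sJ] sIJ; apply/eqP; rewrite eq_sym eqEcard sIJ /= cI.
  by apply: leq_trans le_r; exact: card_indep_le_rank.
by have /(subsetP sI) := eI; rewrite setD11.
Qed.

(* Among the sets attaining the minimum, one of least rank is cyclic and, if it
   is moreover of largest size, it is a flat. *)
Lemma rank_cyclic_flat X :
  X \subset ground M ->
  exists2 A, cyclic_flat M A & rank M X = rank M A + #|X :\: A|.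
Proof.
move=> sX.
pose P A := (A \subset ground M) && (rank M A + #|X :\: A| == rank M X).
(* Since [#|~: A| <= #|T|], minimizing [w] is lexicographic: least rank first, then largest size. *)
pose w A := rank M A * #|T|.+1 + #|~: A|.
have PX : P X by rewrite /P sX setDv cards0 addn0 eqxx.
case: (arg_minnP w PX) => A /andP[sA /eqP eA] minA.
exists A => //; split; first (split=> //).
- move=> e /setDP[eM eA']; rewrite ltn_neqAle rank_mono ?subsetUr // andbT.
  apply/eqP => er.
  have sD : #|X :\: (e |: A)| <= #|X :\: A|.
    by apply: subset_leq_card; apply: setDS; exact: subsetUr.
  have cA : #|~: (e |: A)| < #|~: A|.
    by apply: proper_card; rewrite properC properUr // sub1set.
  have := rank_le_add_card X (e |: A); rewrite -er => le_r.
  have := minA (e |: A); rewrite /P /w subUset sub1set eM sA -er /=.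
  by lia.
- move=> e /rank_coloop[eA' ltr].
  have sD : #|X :\: (A :\ e)| <= #|X :\: A|.+1.
    apply: leq_trans (_ : #|e |: (X :\: A)| <= _).
      by apply: subset_leq_card; apply/subsetP => x; rewrite !inE; case: eqP.
    by rewrite cardsU1; lia.
  have cA : #|~: (A :\ e)| <= #|T| by exact: max_card.
  have le_r := rank_le_add_card X (A :\ e).
  have eA1 : rank M (A :\ e) + #|X :\: (A :\ e)| == rank M X by lia.
  have := minA (A :\ e); rewrite /P /w (subset_trans (subsetDl _ _) sA) eA1.
  move/(_ isT); have := leq_mul ltr (leqnn #|T|.+1).
  by rewrite mulSn; lia.
Qed.

(** * Vertical separations and connectivity *)

Lemma mrank_le_sides X :
  X \subset ground M -> mrank M <= rank M X + rank M (ground M :\: X).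
Proof.
by move=> sX; rewrite /mrank -{1}(setID (ground M) X) (setIidPr sX) rank_subadd.
Qed.

(** The order of the separation is below [k], hence below the rank of either side, so the other side
    is nonspanning; [mrank_le_sides] makes the subtraction in [lambda] exact. *)
Lemma vertical_separation_nonspanning X k :
  vertical_separation M k X ->
  [/\ rank M X < mrank M, rank M (ground M :\: X) < mrank M
    & rank M X + rank M (ground M :\: X) < mrank M + k].
Proof.
by case/and4P=> sX; rewrite /lambda; have := mrank_le_sides sX; split; lia.
Qed.

Lemma kappa_le X k : vertical_separation M k X -> kappa M <= k.
Proof.
move=> sep; have hk : has_vertical_separation M k by apply/existsP; exists X.
rewrite /kappa; case: has_vertical_separation_dec => [ex_k|[]]; last by exists k.
by case: ex_minnP => m _; apply.
Qed.

(** Either disjunct rules out the default value [mrank M]; the first serves for the matroid, the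
    second for its expansion. *)
Lemma kappa_attained :
  kappa M < mrank M \/ (exists k, has_vertical_separation M k) ->
  exists X, vertical_separation M (kappa M) X.
Proof.
rewrite /kappa; case: has_vertical_separation_dec => [ex_k _|nex].
  by case: ex_minnP => m /existsP.
by case=> [|/nex//]; rewrite ltnn.
Qed.

Lemma kappa_le_nonspanning X :
  X \subset ground M -> rank M X < mrank M ->
  rank M (ground M :\: X) < mrank M ->
  kappa M + mrank M <= rank M X + rank M (ground M :\: X) + 1.
Proof.
move=> sX ltX ltX'; have le_r := mrank_le_sides sX.
(* [lambda M X < rank M X] says exactly that the complement is nonspanning, and symmetrically. *)
have : vertical_separation M (lambda M X).+1 X.
  by apply/and4P; split=> //; rewrite /lambda; lia.
by move/kappa_le; rewrite /lambda; lia.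
Qed.

Lemma cyclic_flat_sub A : cyclic_flat M A -> A \subset ground M.
Proof. by case=> [[]]. Qed.

Lemma kappa_le_cover A B :
  kappa M < mrank M -> A \subset ground M ->
  rank M A < mrank M -> rank M B < mrank M ->
  kappa M + mrank M <= rank M A + rank M B + #|ground M :\: (A :|: B)| + 1.
Proof.
move=> kM sA ltA ltB; set R := ground M :\: (A :|: B).
have [large|small] := leqP (mrank M + mrank M - 1) (rank M A + rank M B + #|R|).
  by lia.
(* Give [A] as many elements of [R] as its rank bound allows; by [small] the rest still fit with
   [B]. *)
pose p := minn #|R| (mrank M - 1 - rank M A).
have /card_geqP[s [us cs ss]] : p <= #|R| by exact: geq_minl.
pose C := [set x in s]; pose X := A :|: C.
have cC : #|C| = p by rewrite cardsE -cs; exact/card_uniqP.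
have sC : C \subset R by apply/subsetP => x; rewrite inE => /ss.
have sX : X \subset ground M by rewrite subUset sA (subset_trans sC (subsetDl _ _)).
have rX : rank M X <= rank M A + p.
  by apply: leq_trans (rank_subadd _ _) _; rewrite leq_add2l -cC rank_le_card.
have rX' : rank M (ground M :\: X) <= rank M B + (#|R| - p).
  apply: leq_trans (rank_le_add_card _ B) _; rewrite leq_add2l.
  have -> : (ground M :\: X) :\: B = R :\: C.
    by apply/setP => x; rewrite !inE; do 4?case: (_ \in _).
  by rewrite cardsD (setIidPr sC) cC.
have := @kappa_le_nonspanning X sX.
by rewrite /p in rX rX' *; lia.
Qed.

End Rank.

(** * Ranks and separations in the expansion *)

Section Expansion.
Set Implicit Arguments.
Unset Strict Implicit.
Variables (T : finType) (M N : matroid T) (t : nat) (S : T -> {set T}).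
Hypothesis exp_N : is_expansion M t S N.
Implicit Types (X Y A B : {set T}).

Lemma SX_setU X Y : SX S (X :|: Y) = SX S X :|: SX S Y.
Proof. exact: bigcup_setU. Qed.

Lemma SX_setD X A :
  X \subset ground M -> A \subset ground M ->
  SX S (X :\: A) = SX S X :\: SX S A.
Proof.
case: exp_N => _ dS _ _ _ sX sA; apply/setP => x; rewrite inE.
apply/bigcupP/andP => [[e /setDP[eX eA] xe]|[xA /bigcupP[e eX xe]]].
  split; last by apply/bigcupP; exists e.
  apply/bigcupP => -[f fA xf].
  have nef : e != f by apply: contraNneq eA => ->.
  by have /disjoint_setI0/setP/(_ x) := dS _ _ (subsetP sX _ eX) (subsetP sA _ fA) nef;
     rewrite !inE xe xf.
exists e => //; rewrite inE eX andbT; apply: contra xA => eA.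
by apply/bigcupP; exists e.
Qed.

Lemma card_SX X : X \subset ground M -> #|SX S X| = t * #|X|.
Proof.
case: exp_N => cS dS _ _ _.
elim: {X}#|X| {-2}X (erefl #|X|) => [|n IHn] X cX sX.
  by move/eqP: cX; rewrite cards_eq0 => /eqP ->; rewrite /SX big_set0 cards0 muln0.
have /card_gt0P[e eX] : 0 < #|X| by rewrite cX.
have cXe : #|X :\ e| = n by move: cX; rewrite (cardsD1 e) eX => -[].
have sXe : X :\ e \subset ground M by exact: subset_trans (subsetDl _ _) sX.
have eM := subsetP sX _ eX.
rewrite -(setD1K eX) SX_setU cardsU.
have -> : SX S [set e] = S e by rewrite /SX big_set1.
have -> : S e :&: SX S (X :\ e) = set0.
  apply/setP => x; rewrite !inE; apply/andP => -[xe /bigcupP[f /setD1P[nfe fX] xf]].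
  by have /disjoint_setI0/setP/(_ x) := dS _ _ (subsetP sX _ fX) eM nfe;
     rewrite !inE xe xf.
by rewrite cards0 subn0 IHn // (cS _ eM).2 cardsU1 setD11 cXe; lia.
Qed.

Lemma rank_expansion_cyclic_flat Y :
  Y \subset ground N ->
  exists2 A, cyclic_flat M A & rank N Y = t * rank M A + #|Y :\: SX S A|.
Proof.
case: exp_N => _ _ _ cfN rN /rank_cyclic_flat[F /cfN[A cA ->] ->].
by exists A; rewrite ?rN.
Qed.

Lemma SX_sub_ground X : X \subset ground M -> SX S X \subset ground N.
Proof.
case: exp_N => _ _ -> _ _ sX; apply/bigcupsP => e eX.
by apply: bigcup_sup; exact: subsetP eX.
Qed.

(** Each inequality evaluates the general bound of one matroid at a cyclic flat attaining the
    minimum for the other; the two expressions differ by the factor [t]. *)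
Lemma rank_expansion X : X \subset ground M -> rank N (SX S X) = t * rank M X.
Proof.
move=> sX; have [_ _ _ _ rN] := exp_N.
have cD A : cyclic_flat M A -> #|SX S X :\: SX S A| = t * #|X :\: A|.
  move=> /cyclic_flat_sub sA; rewrite -SX_setD // card_SX //.
  exact: subset_trans (subsetDl _ _) sX.
apply/eqP; rewrite eqn_leq; apply/andP; split.
  have [A cA ->] := rank_cyclic_flat sX.
  apply: leq_trans (rank_le_add_card _ _ (SX S A)) _.
  by rewrite rN // cD // mulnDr.
have [A cA ->] := rank_expansion_cyclic_flat (SX_sub_ground sX).
by rewrite cD // -mulnDr leq_mul2l rank_le_add_card orbT.
Qed.

Lemma mrank_expansion : mrank N = t * mrank M.
Proof. by rewrite /mrank -rank_expansion //; case: exp_N => _ _ ->. Qed.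

Lemma expansion_vertical_separation X k :
  0 < t -> vertical_separation M k X ->
  vertical_separation N (t * (k - 1) + 1) (SX S X).
Proof.
move=> t0 sep; have [sX kX kX' lam] := and4P sep.
have [_ _ ltr] := vertical_separation_nonspanning sep.
have sX' : ground M :\: X \subset ground M by exact: subsetDl.
rewrite /vertical_separation SX_sub_ground //= /lambda.
have -> : ground N :\: SX S X = SX S (ground M :\: X).
  by rewrite SX_setD //; case: exp_N => _ _ ->.
rewrite !rank_expansion // mrank_expansion.
(* The order scales to at most [t * (k - 1)], and [t * k >= t * (k - 1) + 1] as [t] is positive. *)
by apply/and3P; split; nia.
Qed.

Lemma kappa_expansion_ge Y k :
  0 < t -> kappa M < mrank M -> vertical_separation N k Y ->
  t * (kappa M - 1) + 1 <= k.
Proof.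
(* [k0] covers the case where [kappa M - 1] truncates. *)
move=> t0 kM sep; have [sY _ _ /(leq_ltn_trans (leq0n _)) k0] := and4P sep.
have [] := vertical_separation_nonspanning sep; rewrite mrank_expansion.
have [A cA ->] := rank_expansion_cyclic_flat sY.
have [B cB ->] := rank_expansion_cyclic_flat (subsetDl (ground N) Y).
have sA := cyclic_flat_sub cA; have sB := cyclic_flat_sub cB.
set R := ground M :\: (A :|: B).
(* A point of [SX S R] avoids both expanded flats, so it is counted on whichever side of [Y] it
   lies. *)
have cR : t * #|R| <= #|Y :\: SX S A| + #|(ground N :\: Y) :\: SX S B|.
  rewrite -card_SX ?subsetDl // SX_setD ?subUset ?sA // SX_setU.
  have [_ _ <- _ _] := exp_N.
  apply: leq_trans (leq_card_setU _ _); apply: subset_leq_card.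
  by apply/subsetP => x; rewrite !inE; do 4?case: (_ \in _).
move=> ltA ltB ltr.
have rA : rank M A < mrank M by nia.
have rB : rank M B < mrank M by nia.
have := leq_mul (leqnn t) (kappa_le_cover kM sA rA rB).
by rewrite -/R mulnBr !mulnDr muln1; lia.
Qed.

End Expansion.

Theorem theorem5p1 (T : finType) (M : matroid T) :
  kappa M < mrank M ->
  forall (t : nat) (S : T -> {set T}) (N : matroid T),
    0 < t -> is_expansion M t S N ->
    kappa N = t * (kappa M - 1) + 1.
Proof.
move=> kM t S N t0 exp_N.
have [X sepX] := kappa_attained (or_introl kM).
have sepN := expansion_vertical_separation exp_N t0 sepX.
have [|Y sepY] := @kappa_attained _ N.
  by right; exists (t * (kappa M - 1) + 1); apply/existsP; exists (SX S X).
apply/eqP; rewrite eqn_leq (kappa_le sepN).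
exact: (kappa_expansion_ge exp_N t0 kM sepY).
Qed.
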